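(* Let $X$ be a real Banach space and let $Y,Z$ be closed subspaces of $X$ such that $Z\subseteq Y\subseteq X$. Suppose $Z$ is an $M$-ideal in $X$ and $Y/Z$ has property-$SU$ in $X/Z$. Then $Y$ has property-$SU$ in $X$.
   Context: All Banach spaces are real and subspaces are closed. For a closed subspace $Y$ of a Banach space $X$, $Y^\perp\subseteq X^*$ denotes the annihilator of $Y$. $Y$ has property-$SU$ in $X$ if $Y^\perp$ has a complementary subspace $G\subseteq X^*$ such that for every $f\in X^*$, writing $f=g+h$ with $g\in G$, $h\in Y^\perp$, one has $\|f\|>\|g\|$ whenever $h\neq 0$. A subspace $Z$ of $X$ is an $M$-ideal in $X$ if $Z^\perp$ is an $L$-summand in $X^*$, i.e. it is the range of a linear projection $P:X^*\to X^*$ with $\|f\|=\|Pf\|+\|f-Pf\|$ for all $f\in X^*$. *)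

(* Defs.v *)
From HB Require Import structures.
From mathcomp Require Import all_boot all_order all_algebra ring_quotient.
From mathcomp Require Import all_classical all_reals all_analysis.
Import Order.TTheory GRing.Theory Num.Theory.
Import numFieldNormedType.Exports.

Set Implicit Arguments.
Unset Strict Implicit.
Unset Printing Implicit Defensive.

Local Open Scope classical_set_scope.
Local Open Scope ring_scope.
Local Open Scope quotient_scope.

Record closedSubspace (R : realType) (X : normedModType R) := ClosedSubspace {
  subspace_pred :> {pred X};
  subspace_submod_closed : submod_closed subspace_pred;
  subspace_closed : closed [set` subspace_pred]
}.

HB.instance Definition _ (R : realType) (X : normedModType R)
    (S : closedSubspace X) :=
  GRing.isSubmodClosed.Build R X (subspace_pred S) (subspace_submod_closed S).

Section Dual.
Variables (R : realType) (X : normedModType R).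

Definition linear_continuous : {pred X -> R^o} :=
  [pred f | `[< linear f /\ continuous f >]].

Record dual := Dual {
  dual_val :> X -> R^o;
  dual_valP : dual_val \in linear_continuous
}.

HB.instance Definition _ := [isSub for dual_val].
HB.instance Definition _ := [Choice of dual by <:].

Lemma linear_continuous_submod_closed : submod_closed linear_continuous.
Proof.
split.
  apply/asboolP; split; last exact: cst_continuous.
  by move=> a x y /=; rewrite /GRing.zero /= /cst scaler0 addr0.
move=> a f g /asboolP[lf cf] /asboolP[lg cg]; apply/asboolP; split.
  move=> b x y; rewrite !fctE lf lg !scalerDr !scalerA (mulrC a b).
  by rewrite addrACA.
by move=> x; apply: cvgD; [apply: cvgZr; exact: cf|exact: cg].
Qed.

HB.instance Definition _ := GRing.isSubmodClosed.Build R (X -> R^o)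
  linear_continuous linear_continuous_submod_closed.
HB.instance Definition _ := [SubChoice_isSubLmodule of dual by <:].

Lemma dual_linear (f : dual) : linear f.
Proof. by have /asboolP[] := dual_valP f. Qed.

Lemma dual_continuous (f : dual) : continuous (f : X -> R^o).
Proof. by have /asboolP[] := dual_valP f. Qed.

HB.instance Definition _ (f : dual) :=
  GRing.isLinear.Build R X R^o _ (dual_val f) (dual_linear f).

Lemma dualP (f g : dual) : (forall x, f x = g x) -> f = g.
Proof. by move=> fg; apply/val_inj/funext. Qed.

Lemma dualDE (f g : dual) x : (f + g) x = f x + g x.
Proof. by []. Qed.

Lemma dualBE (f g : dual) x : (f - g) x = f x - g x.
Proof. by []. Qed.

Lemma dualZE a (f : dual) x : (a *: f) x = a * f x.
Proof. by []. Qed.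

Lemma dual0E x : (0 : dual) x = 0.
Proof. by []. Qed.

Definition dual_norm (f : dual) : R := sup [set `|f x| | x in [set x | `|x| <= 1]].

Lemma dual_norm_set0 (f : dual) :
  [set `|f x| | x in [set x | `|x| <= 1]] !=set0.
Proof. by exists `|f 0|, 0 => //=; rewrite normr0. Qed.

Lemma dual_bounded (f : dual) : has_ubound [set `|f x| | x in [set x | `|x| <= 1]].
Proof.
have /linear_bounded_continuous/bounded_funP/(_ 1)[M fM] := @dual_continuous f.
by exists M => _ [x /= x1 <-]; exact: fM.
Qed.

Lemma dual_norm_ball (f : dual) x : `|x| <= 1 -> `|f x| <= dual_norm f.
Proof. by move=> x1; apply: ub_le_sup; [exact: dual_bounded|exists x]. Qed.

Lemma dual_norm_le (f : dual) (c : R) :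
  (forall x, `|x| <= 1 -> `|f x| <= c) -> dual_norm f <= c.
Proof.
move=> fc; apply: ge_sup; first exact: dual_norm_set0.
by move=> _ [x /= x1 <-]; exact: fc.
Qed.

Lemma dual_norm_ge0 (f : dual) : 0 <= dual_norm f.
Proof. by apply: le_trans (@dual_norm_ball f 0 _); rewrite ?normr0. Qed.

Lemma dual_normP (f : dual) x : `|f x| <= dual_norm f * `|x|.
Proof.
have [->|x0] := eqVneq x 0; first by rewrite linear0 !normr0 mulr0.
have nx : 0 < `|x| by rewrite normr_gt0.
rewrite -ler_pdivrMr//.
have -> : `|f x| / `|x| = `|f (`|x|^-1 *: x)|.
  by rewrite linearZ /= normrM normfV normr_id mulrC.
by apply: dual_norm_ball; rewrite normrZ normfV normr_id mulVf// gt_eqF.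
Qed.

Lemma dual_normD (f g : dual) : dual_norm (f + g) <= dual_norm f + dual_norm g.
Proof.
apply: dual_norm_le => x x1; rewrite dualDE (le_trans (ler_normD _ _))//.
by apply: lerD; exact: dual_norm_ball.
Qed.

Lemma dual_normZ a (f : dual) : dual_norm (a *: f) = `|a| * dual_norm f.
Proof.
have le b g : dual_norm (b *: g) <= `|b| * dual_norm g.
  apply: dual_norm_le => x x1; rewrite dualZE normrM.
  by apply: ler_wpM2l => //; exact: dual_norm_ball.
apply/eqP; rewrite eq_le le /=.
have [->|a0] := eqVneq a 0; first by rewrite normr0 mul0r dual_norm_ge0.
rewrite -ler_pdivlMl ?normr_gt0// -normfV.
by rewrite (le_trans _ (le _ _))// scalerA mulVf// scale1r.
Qed.

Lemma dual_norm0_eq0 (f : dual) : dual_norm f = 0 -> f = 0.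
Proof.
move=> f0; apply: dualP => x; apply/eqP; rewrite dual0E -normr_le0.
by rewrite (le_trans (dual_normP f x))// f0 mul0r.
Qed.

HB.instance Definition _ :=
  Lmodule_isNormed.Build R dual dual_normD dual_normZ dual_norm0_eq0.

Lemma dualNE (f : dual) : `|f| = dual_norm f.
Proof. by []. Qed.

End Dual.

Section Annihilator.
Variables (R : realType) (X : normedModType R) (Y : closedSubspace X).

Definition annihilator_pred : {pred dual X} :=
  [pred f : dual X | `[< forall x, x \in Y -> f x = 0 >]].

Lemma annihilator_predP (f : dual X) :
  reflect (forall x, x \in Y -> f x = 0) (f \in annihilator_pred).
Proof. exact: asboolP. Qed.

Lemma annihilator_submod_closed : submod_closed annihilator_pred.
Proof.
split; first exact/annihilator_predP.
move=> a f g /annihilator_predP f0 /annihilator_predP g0; apply/annihilator_predP => x xY.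
by rewrite dualDE dualZE f0// g0// mulr0 addr0.
Qed.

Lemma annihilator_closed : closed [set` annihilator_pred].
Proof.
move=> f fcl /=; apply/annihilator_predP => x xY; apply/eqP.
rewrite -normr_le0; apply/ler_addgt0Pl => e e0; rewrite addr0.
have d0 : 0 < e / (`|x| + 1) by rewrite divr_gt0// ltr_pwDr.
have [g [/= /annihilator_predP g0 fg]] := fcl _ (nbhsx_ballx f _ d0).
move: fg; rewrite -ball_normE /= dualNE => fg.
have := dual_normP (f - g) x; rewrite dualBE g0// subr0 => /le_trans; apply.
apply: (@le_trans _ _ (e / (`|x| + 1) * (`|x| + 1))).
  by apply: ler_pM => //; [exact: dual_norm_ge0|exact: ltW|rewrite lerDl].
by rewrite divfK// gt_eqF// ltr_pwDr.
Qed.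

Definition annihilator : closedSubspace (dual X) :=
  ClosedSubspace annihilator_submod_closed annihilator_closed.

Lemma annihilatorP (f : dual X) :
  reflect (forall x, x \in Y -> f x = 0) (f \in annihilator).
Proof. exact: annihilator_predP. Qed.

End Annihilator.

Section QuotientSpace.
Variables (R : realType) (X : normedModType R) (Z : closedSubspace X).

Definition quotient_space : Type := Quotient.quot Z.

HB.instance Definition _ := GRing.Zmodule.on quotient_space.
HB.instance Definition _ :=
  ZmodQuotient.copy quotient_space (Quotient.quot Z).

Local Notation Q := quotient_space.
Implicit Types q : Q.

Definition quotient_map (x : X) : Q := \pi_Q x.
Local Notation pi := quotient_map.

Lemma quotient_mapE x y : pi x = pi y <-> x - y \in Z.
Proof.
rewrite /quotient_map; split=> [/eqP|xy]; first by rewrite -Quotient.idealrBE.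
by apply/eqP; rewrite -Quotient.idealrBE.
Qed.

Lemma quotient_map_surj q : exists x, pi x = q.
Proof. by exists (repr q); rewrite /quotient_map reprK. Qed.

Lemma quotient_mapD x y : pi (x + y) = pi x + pi y.
Proof. exact: raddfD. Qed.

Definition quotient_scale (a : R) q : Q := pi (a *: repr q).

Lemma quotient_scaleE a x : quotient_scale a (pi x) = pi (a *: x).
Proof.
rewrite /quotient_scale; apply/quotient_mapE; rewrite -scalerBr rpredZ//.
by apply/quotient_mapE; rewrite /quotient_map reprK.
Qed.

Fact quotient_scaleA a b q :
  quotient_scale a (quotient_scale b q) = quotient_scale (a * b) q.
Proof.
by have [x <-] := quotient_map_surj q; rewrite !quotient_scaleE scalerA.
Qed.

Fact quotient_scale1 : left_id 1 quotient_scale.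
Proof.
by move=> q; have [x <-] := quotient_map_surj q; rewrite quotient_scaleE scale1r.
Qed.

Fact quotient_scaleDr : right_distributive quotient_scale +%R.
Proof.
move=> a p q.
have [x <-] := quotient_map_surj p; have [y <-] := quotient_map_surj q.
by rewrite -quotient_mapD !quotient_scaleE scalerDr quotient_mapD.
Qed.

Fact quotient_scaleDl q : {morph quotient_scale^~ q : a b / a + b}.
Proof.
move=> a b; have [x <-] := quotient_map_surj q.
by rewrite !quotient_scaleE scalerDl quotient_mapD.
Qed.

HB.instance Definition _ := GRing.Zmodule_isLmodule.Build R Q
  quotient_scaleA quotient_scale1 quotient_scaleDr quotient_scaleDl.

Lemma quotient_map_linear : linear pi.
Proof. by move=> a x y; rewrite quotient_mapD -quotient_scaleE. Qed.

HB.instance Definition _ := GRing.isLinear.Build R X Q _ pi quotient_map_linear.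

Definition quotient_norm q : R := inf [set `|x| | x in [set x | pi x = q]].

Lemma quotient_norm_has_inf q : has_inf [set `|x| | x in [set x | pi x = q]].
Proof.
split; last by exists 0 => _ [x _ <-].
by have [x xq] := quotient_map_surj q; exists `|x|, x.
Qed.

Lemma quotient_norm_le x : quotient_norm (pi x) <= `|x|.
Proof.
by apply: ge_inf; [exact: (quotient_norm_has_inf _).2|exists x].
Qed.

Lemma quotient_norm_ge0 q : 0 <= quotient_norm q.
Proof.
apply: lb_le_inf; first exact: (quotient_norm_has_inf _).1.
by move=> _ [x _ <-].
Qed.

Lemma quotient_norm_adherent q (e : R) : 0 < e ->
  exists2 x, pi x = q & `|x| < quotient_norm q + e.
Proof.
move=> e0; have [_ [x xq <-] xe] := inf_adherent e0 (quotient_norm_has_inf q).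
by exists x.
Qed.

Lemma quotient_normD p q :
  quotient_norm (p + q) <= quotient_norm p + quotient_norm q.
Proof.
apply/ler_addgt0Pr => e e0.
have e20 : 0 < e / 2 by rewrite divr_gt0.
have [x <- xp] := quotient_norm_adherent p e20.
have [y <- yq] := quotient_norm_adherent q e20.
rewrite -quotient_mapD (le_trans (quotient_norm_le _))//.
rewrite (le_trans (ler_normD _ _))// (splitr e) addrACA.
by apply: lerD; exact: ltW.
Qed.

Lemma quotient_normZ a q : quotient_norm (a *: q) = `|a| * quotient_norm q.
Proof.
have le b p : quotient_norm (b *: p) <= `|b| * quotient_norm p.
  have [->|b0] := eqVneq b 0.
    rewrite scale0r normr0 mul0r -(linear0 pi).
    by rewrite (le_trans (quotient_norm_le 0))// normr0.
  rewrite -ler_pdivrMl ?normr_gt0//; apply: lb_le_inf.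
    exact: (quotient_norm_has_inf _).1.
  move=> _ [x <- <-]; rewrite ler_pdivrMl ?normr_gt0// -normrZ -linearZ.
  exact: quotient_norm_le.
apply/eqP; rewrite eq_le le /=.
have [->|a0] := eqVneq a 0; first by rewrite normr0 mul0r quotient_norm_ge0.
rewrite -ler_pdivlMl ?normr_gt0// -normfV.
by rewrite (le_trans _ (le _ _))// scalerA mulVf// scale1r.
Qed.

Lemma quotient_norm0_eq0 q : quotient_norm q = 0 -> q = 0.
Proof.
have [x <-] := quotient_map_surj q => x0.
rewrite -(linear0 pi); apply/quotient_mapE; rewrite subr0.
apply: (subspace_closed (c := Z)) => B /nbhs_ballP[e /= e0 eB].
have [y yx] := quotient_norm_adherent (pi x) e0.
rewrite x0 add0r => ye; exists (x - y); split=> /=.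
  by apply/quotient_mapE.
by apply: eB; rewrite -ball_normE /= opprB addrC subrK.
Qed.

HB.instance Definition _ :=
  Lmodule_isNormed.Build R Q quotient_normD quotient_normZ quotient_norm0_eq0.

End QuotientSpace.

Section QuotientSubspace.
Variables (R : realType) (X : normedModType R) (Z Y : closedSubspace X).
Variable ZY : {subset Z <= Y}.

Definition quotient_subspace_pred : {pred quotient_space Z} :=
  [pred q | `[< exists2 y, y \in Y & quotient_map Z y = q >]].

Local Notation S := quotient_subspace_pred.

Lemma quotient_subspace_predP q :
  reflect (exists2 y, y \in Y & quotient_map Z y = q) (q \in S).
Proof. exact: asboolP. Qed.

Lemma quotient_map_subspace x : (quotient_map Z x \in S) = (x \in Y).
Proof.
apply/quotient_subspace_predP/idP => [[y yY /quotient_mapE/ZY yx]|xY]; last by exists x.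
by rewrite -(subKr y x) rpredB.
Qed.

Lemma quotient_subspace_submod_closed : submod_closed S.
Proof.
split; first by rewrite -(linear0 (quotient_map Z)) quotient_map_subspace rpred0.
move=> a p q /quotient_subspace_predP[x xY <-] /quotient_subspace_predP[y yY <-].
by rewrite -linearP quotient_map_subspace rpredD// rpredZ.
Qed.

Lemma quotient_subspace_closed : closed [set` S].
Proof.
move=> q; have [x <-] := quotient_map_surj q => xcl /=.
rewrite quotient_map_subspace.
apply: (subspace_closed (c := Y)) => B /nbhs_ballP[e /= e0 eB].
have [p [/= /quotient_subspace_predP[y yY <-]]] := xcl _ (nbhsx_ballx _ _ e0).
rewrite -ball_normE /= -linearB => xye.
have [w wxy we] : exists2 w, quotient_map Z w = quotient_map Z (x - y) & `|w| < e.
  have d0 : 0 < e - `|quotient_map Z (x - y)| by rewrite subr_gt0.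
  by have [w wxy] := quotient_norm_adherent (quotient_map Z (x - y)) d0;
    rewrite addrC subrK => we; exists w.
exists (x - w); split=> /=.
  rewrite -quotient_map_subspace.
  suff -> : quotient_map Z (x - w) = quotient_map Z y.
    by rewrite quotient_map_subspace.
  by rewrite linearB /= wxy linearB /= subKr.
by apply: eB; rewrite -ball_normE /= opprB addrC subrK.
Qed.

(* Y/Z is the image of Y in X/Z; the inclusion ZY is what makes it closed *)
Definition quotient_subspace : closedSubspace (quotient_space Z) :=
  ClosedSubspace quotient_subspace_submod_closed quotient_subspace_closed.

Lemma quotient_subspaceP q : reflect
  (exists2 y, y \in Y & quotient_map Z y = q) (q \in quotient_subspace).
Proof. exact: quotient_subspace_predP. Qed.

End QuotientSubspace.

Definition complementary (R : realType) (E : normedModType R)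
    (A B : closedSubspace E) : Prop :=
  (forall x, exists a b, [/\ a \in A, b \in B & x = a + b]) /\
  (forall x, x \in A -> x \in B -> x = 0).

Definition property_SU (R : realType) (X : normedModType R)
    (Y : closedSubspace X) : Prop :=
  exists G : closedSubspace (dual X),
    complementary G (annihilator Y) /\
    forall f g h : dual X, g \in G -> h \in annihilator Y -> f = g + h ->
      h != 0 -> `|f| > `|g|.

Definition L_summand (R : realType) (E : normedModType R)
    (V : closedSubspace E) : Prop :=
  exists P : {linear E -> E},
    [/\ forall f, P (P f) = P f,
        range P = [set` V] &
        forall f, `|f| = `|P f| + `|f - P f|].

Definition M_ideal (R : realType) (X : normedModType R)
    (Z : closedSubspace X) : Prop := L_summand (annihilator Z).

(* Main.v *)
Require Import Defs.
From HB Require Import structures.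
From mathcomp Require Import all_boot all_order all_algebra.
From mathcomp Require Import all_classical all_reals all_analysis.
Import Order.TTheory GRing.Theory Num.Theory.
Import numFieldNormedType.Exports.

Local Open Scope classical_set_scope.
Local Open Scope ring_scope.

(** Composition with the quotient map identifies [(X/Z)^*] isometrically with
    [Z^perp] and [(Y/Z)^perp] with [Y^perp].  If [P] is the L-projection onto
    [Z^perp] and [G'] is the complement of [(Y/Z)^perp] given by property-SU,
    then [G], the set of all [f] such that [P f] lies in the copy of [G'] inside
    [Z^perp], is a complement of [Y^perp].  For [g] in [G] and [h <> 0] in
    [Y^perp], [P (g + h) = P g + h], so
    [|g + h| = |P g + h| + |g - P g| > |P g| + |g - P g| = |g|]. *)

(** A linear map bounded on bounded sets is continuous. This builds functionals on [X] and on [X/Z]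
    alike. *)
Lemma bounded_linear_dual {R : realType} {X : normedModType R} (f : X -> R^o)
    (c : R) :
  linear f -> (forall x, `|f x| <= c * `|x|) -> exists g : dual X, g =1 f.
Proof.
move=> lf fc; pose L := GRing.isLinear.Build R X R^o _ f lf.
pose F : {linear X -> R^o} := HB.pack f L.
have cf : continuous F.
  (* Absolute values, as [c] and the radius [r] may have any sign. *)
  apply/linear_bounded_continuous/bounded_funP => r; exists (`|c| * `|r|) => x xr.
  rewrite (le_trans (fc x))// (le_trans (ler_norm _))// normrM normr_id.
  by apply: ler_wpM2l => //; rewrite (le_trans xr)// ler_norm.
have fP : f \in @Defs.linear_continuous R X by apply/asboolP.
by exists (Dual fP).
Qed.

Section QuotientDual.
Context {R : realType} {X : normedModType R} {Z : closedSubspace X}.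
Implicit Types (f : dual X) (phi psi : dual (quotient_space Z)).

Lemma quotient_pullback_linear_continuous phi :
  (phi \o quotient_map Z : X -> R^o) \in @Defs.linear_continuous R X.
Proof.
have lin : linear (phi \o quotient_map Z : X -> R^o).
  by move=> a x y /=; rewrite !linearP.
have [x|g gE] := bounded_linear_dual (phi \o quotient_map Z) (dual_norm phi) lin.
  rewrite (le_trans (dual_normP _ _))//.
  by apply: ler_wpM2l; [exact: dual_norm_ge0|exact: quotient_norm_le].
by rewrite -(funext gE); exact: dual_valP.
Qed.

Definition quotient_pullback phi : dual X :=
  Dual (quotient_pullback_linear_continuous phi).

Lemma quotient_pullback_linear : linear quotient_pullback.
Proof. by move=> a phi psi; apply: dualP. Qed.

HB.instance Definition _ := GRing.isLinear.Build R (dual (quotient_space Z))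
  (dual X) _ quotient_pullback quotient_pullback_linear.

(** Since [f] is constant on the coset of [x], the bound [|f x| <= |f| * |y|] holds for every
    representative [y]; then take the infimum over [y]. *)
Lemma norm_quotient_le f x :
  f \in annihilator Z -> `|f x| <= `|f| * `|quotient_map Z x|.
Proof.
move=> /annihilatorP fZ; have [f0|f0] := eqVneq `|f| 0.
  by rewrite f0 mul0r; have := dual_normP f x; rewrite -dualNE f0 mul0r.
have f_gt0 : 0 < `|f| by rewrite lt0r f0 normr_ge0.
rewrite -ler_pdivrMl//.
apply: lb_le_inf; first exact: (quotient_norm_has_inf _).1.
move=> _ [y /= /quotient_mapE/fZ yx <-].
rewrite ler_pdivrMl//; move/eqP: yx; rewrite linearB subr_eq0 => /eqP <-.
exact: dual_normP.
Qed.

Lemma quotient_pullback_annihilator phi : quotient_pullback phi \in annihilator Z.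
Proof.
apply/annihilatorP => z zZ /=; suff -> : quotient_map Z z = 0 by rewrite linear0.
by rewrite -(linear0 (quotient_map Z)); apply/quotient_mapE; rewrite subr0.
Qed.

(** One inequality holds because the quotient map is a contraction, the other is [norm_quotient_le]
    applied to the pullback. *)
Lemma norm_quotient_pullback phi : `|quotient_pullback phi| = `|phi|.
Proof.
apply/eqP; rewrite eq_le; apply/andP; split; apply: dual_norm_le => x x1.
  apply: (@dual_norm_ball _ _ phi (quotient_map Z x)).
  exact: le_trans (quotient_norm_le _ _) x1.
have [y yx] := quotient_map_surj x.
have := norm_quotient_le _ y (quotient_pullback_annihilator phi).
rewrite /= yx => /le_trans; apply.
by rewrite -[leRHS]mulr1 ler_wpM2l.
Qed.

Lemma quotient_pullback_inj : injective quotient_pullback.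
Proof.
move=> phi psi eq_pp; apply/eqP; rewrite -subr_eq0 -normr_eq0.
by rewrite -norm_quotient_pullback linearB /= eq_pp subrr normr0.
Qed.

(** A functional vanishing on [Z] factors through the quotient map, and [norm_quotient_le] bounds
    the induced map [F]. *)
Lemma quotient_pullback_surj f :
  f \in annihilator Z -> exists phi, quotient_pullback phi = f.
Proof.
move=> fZ; pose F (q : quotient_space Z) : R^o := f (repr q).
have FE x : F (quotient_map Z x) = f x.
  apply/eqP; rewrite -subr_eq0 -linearB; apply/eqP.
  move/annihilatorP: fZ; apply; apply/quotient_mapE.
  by rewrite /quotient_map reprK.
have lF : linear F.
  move=> a p q; have [x <-] := quotient_map_surj p.
  by have [y <-] := quotient_map_surj q; rewrite -linearP !FE linearP.
have [q|phi phiE] := bounded_linear_dual F `|f| lF.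
  by have [x <-] := quotient_map_surj q; rewrite FE; exact: norm_quotient_le.
by exists phi; apply: dualP => x /=; rewrite phiE FE.
Qed.

Lemma quotient_pullback_subspace {Y : closedSubspace X} (ZY : {subset Z <= Y}) phi :
  (quotient_pullback phi \in annihilator Y) =
  (phi \in annihilator (quotient_subspace ZY)).
Proof.
apply/annihilatorP/annihilatorP => [phiY _ /quotient_subspaceP[y yY <-]|phiY y yY].
  exact: (phiY y).
by apply: phiY; apply/quotient_subspaceP; exists y.
Qed.

End QuotientDual.

Section PreimageSubspace.
Context {R : realType} {X : normedModType R} {Z : closedSubspace X}.
Variables (P : {linear dual X -> dual X}) (G : closedSubspace (dual (quotient_space Z))).
Hypothesis PZ : forall f, P f \in annihilator Z.
Hypothesis P_le : forall f, `|P f| <= `|f|.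

(** A preimage under [P] rather than the image of [G]: it also contains the kernel of [P], which a
    complement in all of [dual X] must account for. *)
Definition pullback_preimage_pred : {pred dual X} :=
  [pred f | `[< exists2 phi, phi \in G & quotient_pullback phi = P f >]].

Lemma pullback_preimage_submod_closed : submod_closed pullback_preimage_pred.
Proof.
split; first by apply/asboolP; exists 0; rewrite ?rpred0 // !linear0.
move=> a f g /asboolP[phi phiG phif] /asboolP[psi psiG psig]; apply/asboolP.
by exists (a *: phi + psi); [rewrite rpredD ?rpredZ|rewrite !linearP /= phif psig].
Qed.

(** As [P] is a contraction and the pullback an isometry, [psi] is at least as close to [phi] as [g]
    is to [f]; so [phi] adheres to the closed [G]. *)
Lemma pullback_preimage_closed : closed [set` pullback_preimage_pred].
Proof.
move=> f fcl /=; have [phi phif] := quotient_pullback_surj _ (PZ f).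
apply/asboolP; exists phi => //; apply: (subspace_closed (c := G)).
move=> B /nbhs_ballP[e /= e0 eB].
have [g [/= /asboolP[psi psiG psig] fg]] := fcl _ (nbhsx_ballx f _ e0).
exists psi; split=> //=; apply: eB; move: fg; rewrite -!ball_normE /=.
by apply: le_lt_trans; rewrite -norm_quotient_pullback linearB /= phif psig -linearB.
Qed.

Definition pullback_preimage : closedSubspace (dual X) :=
  ClosedSubspace pullback_preimage_submod_closed pullback_preimage_closed.

Lemma pullback_preimageP f : reflect
  (exists2 phi, phi \in G & quotient_pullback phi = P f) (f \in pullback_preimage).
Proof. exact: asboolP. Qed.

End PreimageSubspace.

Theorem theorem4p5 (R : realType) (X : completeNormedModType R)
    (Y Z : closedSubspace X) (ZY : {subset Z <= Y}) :
  M_ideal Z -> property_SU (quotient_subspace ZY) -> property_SU Y.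
Proof.
move=> [P [PP rP Pnorm]] [G [[Gsum Gcap] GSU]].
have PZ f : P f \in annihilator Z.
  by have : range P (P f) by [exists f]; rewrite rP.
have Pid f : f \in annihilator Z -> P f = f.
  by move=> fZ; have : [set` annihilator Z] f by []; rewrite -rP => -[g _ <-].
have P_le f : `|P f| <= `|f| by rewrite (Pnorm f) lerDl.
have YZ f : f \in annihilator Y -> f \in annihilator Z.
  by move=> /annihilatorP fY; apply/annihilatorP => z /ZY; exact: fY.
have lift f : f \in annihilator Y -> exists2 phi : dual (quotient_space Z),
    phi \in annihilator (quotient_subspace ZY) & quotient_pullback phi = f.
  move=> fY; have [phi phif] := quotient_pullback_surj _ (YZ _ fY).
  by exists phi; rewrite // -quotient_pullback_subspace phif.
exists (pullback_preimage P G PZ P_le); split; first split.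
- move=> f; have [phi phif] := quotient_pullback_surj _ (PZ f).
  have [a [b [aG bY phiE]]] := Gsum phi.
  (* [P] fixes the pullback of [b], so it sends the first summand to the pullback of
     [phi - b = a]. *)
  exists (f - quotient_pullback b), (quotient_pullback b); split.
  + apply/pullback_preimageP; exists a => //.
    rewrite linearB /= (Pid _ (quotient_pullback_annihilator b)) -phif phiE.
    by rewrite linearD addrK.
  + by rewrite quotient_pullback_subspace.
  + by rewrite subrK.
- move=> f /pullback_preimageP[phi phiG phif] fY.
  have [psi psiY psif] := lift f fY.
  (* Here [P f = f], so [phi = psi] lies both in [G] and in the annihilator of [Y/Z]. *)
  move: phif; rewrite (Pid _ (YZ _ fY)) -psif => /quotient_pullback_inj phipsi.
  by rewrite (Gcap psi) ?linear0// -phipsi.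
move=> f g h /pullback_preimageP[phi phiG phig] hY -> h0.
have [psi psiY psih] := lift h hY.
have psi0 : psi != 0 by apply: contraNneq h0 => psi0; rewrite -psih psi0 linear0.
rewrite (Pnorm g) (Pnorm (g + h)) linearD /= (Pid _ (YZ _ hY)).
(* Both sides share the summand [|g - P g|]; cancelling it leaves [|phi| < |phi + psi|] in the dual
   of [X/Z]. *)
rewrite opprD addrACA subrr addr0 ltrD2r -phig -psih -linearD !norm_quotient_pullback.
exact: GSU psiY _ psi0.
Qed.
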